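(* Let $\ell\ge 7$ be odd and let $v\equiv 1\pmod{2\ell}$ be a positive integer. Then there is an equitably $2$-colourable $\ell$-cycle decomposition of $K_v$.
   Context: An $\ell$-cycle decomposition of $K_v$ is a set of $\ell$-cycles whose edge sets partition $E(K_v)$. It is equitably $2$-colourable if there is a colouring of the vertices with two colours such that every cycle contains $\lfloor \ell/2\rfloor$ or $\lceil \ell/2\rceil$ vertices of each colour. *)

(* Defs.v *)
From mathcomp Require Import all_boot.

Set Implicit Arguments.
Unset Strict Implicit.
Unset Printing Implicit Defensive.

(* An edge is a two-element vertex set; a graph without isolated
   vertices (in particular a cycle) is represented by its set of edges, so its
   vertex set is the [cover] of that set. *)

Section CycleDecompositions.

Variable T : finType.

Definition complete_edges : {set {set T}} := [set e : {set T} | #|e| == 2].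

Definition cycle_edges (c : seq T) : {set {set T}} :=
  [set [set x; next c x] | x in c].

Definition is_cycle (l : nat) (C : {set {set T}}) : Prop :=
  2 < l /\ exists2 c : l.-tuple T, uniq c & C = cycle_edges c.

Definition cycle_vertices (C : {set {set T}}) : {set T} := cover C.

Definition cycle_decomposition (l : nat) (E : {set {set T}})
    (D : {set {set {set T}}}) : Prop :=
  (forall C, C \in D -> is_cycle l C) /\ partition D E.

Definition equitably_2_colourable (l : nat) (D : {set {set {set T}}}) : Prop :=
  exists f : T -> bool, forall C, C \in D -> forall b : bool,
    let k := #|[set x in cycle_vertices C | f x == b]| in
    k = l./2 \/ k = uphalf l.

End CycleDecompositions.

Arguments complete_edges T : clear implicits.

(* Main.v *)
(* Write v = 2lm + 1 and colour Z_v by the parity of the residue in [0, v). All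
   translates of a cycle are balanced as soon as its vertices, sorted, alternate
   in parity, so it suffices to find m base cycles of this kind whose differences
   cover Z_v \ {0}; counting edges then shows that nothing is covered twice.
   The m base cycles all come from one labelling of the l-cycle by numbers in
   [0, 2l] which splits the vertices into consecutive independent blocks
   A < M < U with |M| and |U| even: in the j-th base cycle A stays put, M moves
   up by 2lj and U by 2l(m-1-j). A difference d across A thus becomes d + 2lk for
   every k < m, while two differences d and 2l - d between M and U (or the single
   difference l) together become all of d + 2lk and 2l - d + 2lk up to sign.
   Explicit labellings are zigzags, with one family for each odd residue of l
   modulo 8 and two sporadic cases l = 7 and l = 9. *)
Require Import Defs.
From mathcomp Require Import all_boot zify.

Set Implicit Arguments.
Unset Strict Implicit.
Unset Printing Implicit Defensive.

(** * Sequences of alternating parity *)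

Definition alternating (b : bool) (s : seq nat) : Prop :=
  map odd s = traject negb b (size s).

Lemma iter_negb k b : iter k negb b = odd k (+) b.
Proof. by elim: k => //= k ->; case: (odd k); case: b. Qed.

Lemma alternating_cat b s1 s2 :
  alternating b s1 -> alternating (odd (size s1) (+) b) s2 ->
  alternating b (s1 ++ s2).
Proof.
by rewrite /alternating map_cat size_cat trajectD iter_negb => -> ->.
Qed.

Lemma alternating_iota a k b : odd a = b -> alternating b (iota a k).
Proof.
rewrite /alternating size_iota => <-.
by elim: k a => //= k IH a; rewrite IH.
Qed.

Lemma alternating_shift c b s :
  ~~ odd c -> alternating b s -> alternating b [seq x + c | x <- s].
Proof.
rewrite /alternating size_map => /negbTE oc <-; rewrite -map_comp.
by apply: eq_map => x /=; rewrite oddD oc addbF.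
Qed.

Lemma alternating_succ b s :
  alternating b s -> alternating (~~ b) (map S s).
Proof.
rewrite /alternating size_map -map_comp => h.
have -> : [seq (odd \o S) i | i <- s] = map negb (map odd s).
  by rewrite -map_comp; apply: eq_map.
rewrite h; elim: (size s) b {h} => //= k IH b; by rewrite IH.
Qed.

Lemma count_traject_negb k b c : odd k ->
  let h := count (pred1 c) (traject negb b k) in h = k./2 \/ h = uphalf k.
Proof.
move=> ok /=.
have -> : count (pred1 c) (traject negb b k) = if b == c then uphalf k else k./2.
  elim: k b {ok} => [|k IH] b /=; first by case: (b == c).
  by rewrite IH; case: b; case: (c) => /=; lia.
by case: (b == c); [right|left].
Qed.

Lemma alternating_balanced b s c : odd (size s) -> alternating b s ->
  let h := count (fun x => odd x == c) s in
  h = (size s)./2 \/ h = uphalf (size s).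
Proof.
move=> os alt; have := count_traject_negb b c os.
by rewrite -alt count_map.
Qed.

(* Adding 1 modulo the odd number v sends the maximum v - 1, which is even, to
   0; the other parities are flipped, so alternation survives the rotation. *)
Lemma alternating_rotate v b s : odd v -> odd (size s) ->
  sorted ltn s -> all (ltn^~ v) s -> alternating b s ->
  exists b' s', [/\ perm_eq [seq x.+1 %% v | x <- s] s',
    sorted ltn s', all (ltn^~ v) s' & alternating b' s'].
Proof.
move=> ov os ss sv alt.
case: (lastP s) os ss sv alt => // r z os ss sv alt.
have srt t : sorted ltn t -> sorted ltn (map S t).
  by rewrite sorted_map.
have ltz : {in r, forall x, x < z}.
  move=> x xr; move: ss; rewrite -cats1 (sorted_pairwise ltn_trans).
  by rewrite pairwise_cat => /and3P[/allrelP h _ _]; apply: h; rewrite ?inE.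
have zv : z < v by move/allP: sv; apply; rewrite mem_rcons inE eqxx.
have modr : [seq x.+1 %% v | x <- r] = map S r.
  by apply/eq_in_map => x /ltz xz; rewrite modn_small; lia.
have srr : sorted ltn r.
  by move: ss; rewrite -cats1 => /cat_sorted2[].
have [zE|zN] := eqVneq z v.-1; last first.
  exists (~~ b), (map S (rcons r z)); split.
  - by rewrite !map_rcons modr modn_small ?perm_refl //; lia.
  - exact: srt.
  - rewrite all_map; apply/allP => x; rewrite mem_rcons inE /= => /orP[/eqP->|/ltz]; lia.
  - exact: alternating_succ.
exists false, (0 :: map S r); split.
- rewrite map_rcons modr.
  have -> : z.+1 %% v = 0 by rewrite zE prednK ?modnn //; lia.
  by rewrite perm_rcons perm_refl.
- rewrite /= path_sortedE; last exact: ltn_trans.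
  by rewrite srt // andbT all_map; apply/allP.
- by rewrite /= all_map; apply/andP; split; [lia|apply/allP => x /ltz /=; lia].
- move: alt os; rewrite /alternating size_rcons map_rcons.
  rewrite -[(size r).+1]addn1 trajectD cats1 iter_negb.
  move=> /rcons_inj[rE oz] os.
  (* An alternating list of odd length ends with the parity it starts with, and v - 1 is even; so
     the successors start odd and can follow the new 0. *)
  have bE : b = false by move: oz; rewrite zE; move: os ov; case: b {rE}; lia.
  have /= := @alternating_succ b r rE.
  by rewrite bE /alternating /= => ->; rewrite size_map.
Qed.

Lemma alternating_translate v b s t : odd v -> odd (size s) ->
  sorted ltn s -> all (ltn^~ v) s -> alternating b s ->
  exists b' s', [/\ perm_eq [seq (x + t) %% v | x <- s] s',
    sorted ltn s', all (ltn^~ v) s' & alternating b' s'].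
Proof.
move=> ov os ss sv alt; elim: t => [|t [b' [s' [pe ss' sv' alt']]]].
  exists b, s; split=> //; rewrite (_ : map _ s = s) //.
  rewrite -[RHS]map_id; apply/eq_in_map => x /(allP sv) /= xv.
  by rewrite addn0 modn_small.
have os' : odd (size s') by rewrite -(perm_size pe) size_map.
have [b2 [s2 [pe2 ss2 sv2 alt2]]] := alternating_rotate ov os' ss' sv' alt'.
exists b2, s2; split=> //; apply: perm_trans pe2.
apply: perm_trans (perm_map (fun x => x.+1 %% v) pe); rewrite -map_comp.
rewrite (_ : map _ s = [seq ((fun x => x.+1 %% v) \o (fun x => (x + t) %% v)) i | i <- s]) //.
by apply: eq_map => x /=; rewrite addnS -[(x + t).+1]addn1 -[(_ %% _).+1]addn1 modnDml.
Qed.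

(** Counting colours ignores order, so [r] may list the vertices around the cycle while [s] is the
    sorted list. *)
Lemma translate_balanced v b s c t r : odd v -> odd (size s) ->
  sorted ltn s -> all (ltn^~ v) s -> alternating b s -> perm_eq r s ->
  let h := count (fun x => odd x == c) [seq (x + t) %% v | x <- r] in
  h = (size s)./2 \/ h = uphalf (size s).
Proof.
move=> ov os ss sv alt pe /=.
have [b' [s' [pe' _ _ alt']]] := alternating_translate t ov os ss sv alt.
have /permP -> := perm_trans (perm_map (fun x => (x + t) %% v) pe) pe'.
have := @alternating_balanced b' s' c.
by rewrite -(perm_size pe') size_map; apply.
Qed.
(** * Covering the edges of the complete graph *)

Section CycleEdges.

Variable T : finType.
Implicit Types (c : seq T) (x y : T).

Definition next_index (n i : nat) := if i.+1 < n then i.+1 else 0.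

Lemma next_nth_index x0 c i : uniq c -> i < size c ->
  next c (nth x0 c i) = nth x0 c (next_index (size c) i).
Proof.
move=> uc ic; rewrite next_nth mem_nth // /next_index.
case: c uc ic => // y c uc ic; rewrite index_uniq //=.
by case: ltnP => h /=; [apply: set_nth_default|rewrite nth_default].
Qed.

Lemma next_neq c x : uniq c -> 1 < size c -> x \in c -> next c x != x.
Proof.
move=> uc sc xc; have ic : index x c < size c by rewrite index_mem.
have jc : next_index (size c) (index x c) < size c by rewrite /next_index; case: (ltnP _.+1); lia.
have := next_nth_index x uc ic; rewrite nth_index // => ->.
rewrite -[X in _ != X](nth_index x xc) nth_uniq // /next_index.
by case: (ltnP _.+1) => ?; lia.
Qed.

Lemma cover_cycle_edges c : cover (cycle_edges c) = [set x in c].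
Proof.
apply/setP => z; rewrite inE; apply/bigcupP/idP => [[_ /imsetP[x xc ->]]|zc].
  by rewrite !inE => /orP[/eqP->|/eqP->] //; rewrite mem_next.
by exists [set z; next c z]; [apply: imset_f|rewrite !inE eqxx].
Qed.

Lemma card_cycle_edges c : #|cycle_edges c| <= size c.
Proof. by rewrite (leq_trans (leq_imset_card _ _)) ?card_size. Qed.

(* Counting edges with multiplicity forces the cycles to be edge-disjoint. *)
Lemma cycle_partition (I : finType) (n : nat) (E : {set {set T}})
    (c : I -> seq T) :
  2 < n -> (forall i, size (c i) = n /\ uniq (c i)) ->
  (forall i, cycle_edges (c i) \subset E) ->
  (forall e, e \in E -> exists i, e \in cycle_edges (c i)) ->
  #|I| * n <= #|E| ->
  cycle_decomposition n E [set cycle_edges (c i) | i : I].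
Proof.
move=> n2 cP cE Ec IE; set D := [set _ | _ in _]; split=> [C /imsetP[i _ ->]|].
  have [sc uc] := cP i; split=> //.
  by exists (Tuple (introT eqP sc)).
have coverD : cover D = E.
  apply/setP => e; apply/bigcupP/idP => [[_ /imsetP[i _ ->]]|/Ec[i ei]].
    exact: subsetP.
  by exists (cycle_edges (c i)); [apply: imset_f|].
have sumD : \sum_(C in D) #|C| <= #|E|.
  apply: leq_trans IE; apply: (@leq_trans (\sum_(C in D) n)).
    by apply: leq_sum => _ /imsetP[i _ ->]; case: (cP i) => <- _; apply: card_cycle_edges.
  by rewrite sum_nat_const leq_mul2r leq_imset_card orbT.
apply/and3P; split; first by rewrite coverD.
  (* Equality in [leq_card_cover] characterises [trivIset], and [sumD] supplies the reverse
     inequality. *)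
  by rewrite -(geq_leqif (leq_card_cover D)) coverD.
apply/imsetP => -[i _ /setP h]; have [sc _] := cP i.
case: (c i) h sc => [|x r] h sc; first by rewrite -sc in n2.
have : [set x; next (x :: r) x] \in cycle_edges (x :: r).
  by apply: imset_f; apply: mem_head.
by rewrite -h in_set0.
Qed.

End CycleEdges.

(** * Decompositions developed cyclically from base cycles *)

Section Cyclic.

Variables (n m w : nat) (c : nat -> seq nat).
Let v := w.+1.

Hypotheses (n2 : 2 < n) (odd_n : odd n) (wE : w = 2 * n * m).

Hypothesis c_alternating : forall j, j < m -> exists b s,
  [/\ perm_eq (c j) s, sorted ltn s, all (ltn^~ v) s, alternating b s & size s = n].

Hypothesis c_differences : forall d, 0 < d < v -> exists j i,
  [/\ j < m, i < n &
    let x := nth 0 (c j) i in let y := nth 0 (c j) (next_index n i) in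
    x + d = y %[mod v] \/ y + d = x %[mod v]].

Let translate (p : 'I_m * 'I_v) : seq 'I_v :=
  [seq inord ((x + p.2) %% v) | x <- c p.1].

Let odd_v : odd v.
Proof. by rewrite /v wE; lia. Qed.

Let val_translate p : map val (translate p) = [seq (x + p.2) %% v | x <- c p.1].
Proof. by rewrite -map_comp; apply: eq_map => x /=; rewrite inordK ?ltn_pmod. Qed.

Let size_c j : j < m -> size (c j) = n.
Proof. by case/c_alternating => b [s [/perm_size-> _ _ _ ->]]. Qed.

Let uniq_translate p : uniq (translate p).
Proof.
have [b [s [pe ss sv alt sn]]] := c_alternating (ltn_ord p.1).
rewrite -(map_inj_uniq val_inj) val_translate.
have [|b' [s' [pe' ss' _ _]]] := alternating_translate p.2 odd_v _ ss sv alt.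
  by rewrite sn.
rewrite (perm_uniq (perm_trans (perm_map _ pe) pe')).
exact: (sorted_uniq ltn_trans ltnn).
Qed.

Let size_translate p : size (translate p) = n.
Proof. by rewrite size_map size_c. Qed.

(** The m v translates have v(v - 1)/2 = v n m edges in all, exactly as many as the complete graph;
    this is why [c_differences] only asks that each difference occur, not that it occur once. *)
Let card_edges : #|complete_edges 'I_v| = #|{: 'I_m * 'I_v}| * n.
Proof.
by rewrite card_prod !card_ord card_draws card_ord bin2 /v wE; lia.
Qed.

Lemma cyclic_decomposition : exists D : {set {set {set 'I_v}}},
  cycle_decomposition n (complete_edges 'I_v) D /\ equitably_2_colourable n D.
Proof.
exists [set cycle_edges (translate p) | p : 'I_m * 'I_v]; split.
  apply: cycle_partition => //.
  - move=> p; apply/subsetP => _ /imsetP[x xc ->]; rewrite inE cards2 (eq_sym x).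
    by rewrite next_neq // size_translate; lia.
  - move=> e; rewrite inE => /cards2P[x [y [xy ->]]].
    have edge (p q : 'I_v) d j i : j < m -> i < n -> p + d = q %[mod v] ->
        nth 0 (c j) i + d = nth 0 (c j) (next_index n i) %[mod v] ->
        exists k, [set p; q] \in cycle_edges (translate k).
      (* The translation [t] is p minus the i-th label modulo v, written without a truncated
         subtraction; it sends vertex i to p and therefore its successor to q. *)
      move=> jm i_n pq cd; pose t := p + (v - nth 0 (c j) i %% v).
      have tv : t %% v < v by rewrite ltn_pmod.
      exists (Ordinal jm, Ordinal tv); set k := (_, _).
      have nthE i' : i' < n -> nth ord0 (translate k) i' =
          inord ((nth 0 (c j) i' + t) %% v).
        by move=> i'n; rewrite (nth_map 0) ?size_c //= modnDmr.
      have i'n : next_index n i < n by rewrite /next_index; case: (ltnP i.+1) => //; lia.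
      have pE : nth ord0 (translate k) i = p.
        apply: val_inj; rewrite nthE //= inordK ?ltn_pmod // /t.
        rewrite addnCA -modnDmr -[in X in _ + X]modnDml subnKC; last by rewrite ltnW ?ltn_pmod.
        by rewrite modnn addn0 modn_small.
      have qE : nth ord0 (translate k) (next_index n i) = q.
        apply: val_inj; rewrite nthE //= inordK ?ltn_pmod //.
        rewrite -modnDml -cd modnDml addnAC -modnDml.
        move/(congr1 val): pE; rewrite nthE //= inordK ?ltn_pmod // => ->.
        by rewrite pq modn_small.
      have pk : p \in translate k by rewrite -pE mem_nth ?size_translate.
      have := next_nth_index ord0 (uniq_translate k) (i := i).
      rewrite size_translate pE qE => nE.
      by apply/imsetP; exists p; rewrite ?nE.
    have diff (a b : 'I_v) : a != b -> exists2 d, 0 < d < v & a + d = b %[mod v].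
      rewrite -val_eqE neq_ltn /= => /orP[ab|ba].
        exists (b - a); last by rewrite subnKC ?(ltnW ab).
        by move: ab (ltn_ord b); lia.
      exists (v - (a - b)); first by move: ba (ltn_ord a); lia.
      rewrite (_ : a + _ = b + v) ?modnDr //; move: ba (ltn_ord a); lia.
    have [d dv xyd] := diff x y xy.
    have [j [i [jm i_n [cd|cd]]]] := c_differences dv.
      exact: edge xyd cd.
    have dv' : d <= v by lia.
    (* The base edge runs in the direction -d: exchange the ends and use v - d. *)
    rewrite setUC; apply: (edge y x (v - d) j i) => //.
      by rewrite -modnDml -xyd modnDml -addnA subnKC // modnDr.
    by rewrite -modnDml -cd modnDml -addnA subnKC // modnDr.
  - by rewrite card_edges.
exists (fun x : 'I_v => odd x) => _ /imsetP[p _ ->] b /=.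
have -> : [set x in cycle_vertices (cycle_edges (translate p)) | odd x == b] =
          [set x in [seq x <- translate p | odd (val x) == b]].
  by apply/setP => x; rewrite /cycle_vertices cover_cycle_edges !inE mem_filter andbC.
rewrite cardsE (card_uniqP _) ?filter_uniq // size_filter.
rewrite -(count_map val (fun x => odd x == b)) val_translate.
have [b' [s [pe ss sv alt sn]]] := c_alternating (ltn_ord p.1).
by rewrite -sn; apply: translate_balanced sv alt pe; rewrite ?sn.
Qed.

End Cyclic.

(** * Base cycles from a labelling *)

Lemma sorted_ltn_cat k s1 s2 : sorted ltn s1 -> sorted ltn s2 ->
  all (fun x => x < k) s1 -> all (leq k) s2 -> sorted ltn (s1 ++ s2).
Proof.
rewrite !(sorted_pairwise ltn_trans) pairwise_cat => -> -> /allP h1 /allP h2.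
by rewrite !andbT; apply/allrelP => x y /h1 xk /h2; apply: leq_trans.
Qed.

Lemma sorted_shift c s : sorted ltn s -> sorted ltn [seq x + c | x <- s].
Proof.
by move=> h; rewrite sorted_map; apply: sub_sorted h => x y; rewrite /= ltn_add2r.
Qed.

(* Moving the even blocks M and U past each other keeps the parities alternating. *)
Lemma shift_blocks (p q r c d : nat) (A M U : seq nat) (b : bool) :
  odd (size A) -> ~~ odd (size M) -> ~~ odd (size U) ->
  sorted ltn A -> sorted ltn M -> sorted ltn U ->
  all (fun x => x < p) A -> all (fun x => p <= x < q) M ->
  all (fun x => q <= x <= r) U -> p <= q ->
  alternating b A -> alternating (~~ b) M -> alternating (~~ b) U ->
  ~~ odd c -> ~~ odd d -> c <= d \/ d + r <= c ->
  exists s, [/\ perm_eq (A ++ map (addn^~ c) M ++ map (addn^~ d) U) s,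
    sorted ltn s & alternating b s].
Proof.
move=> oA eM eU sA sM sU bA bM bU pq aA aM aU ec ed cd.
(* A has odd size, hence is nonempty. Positivity of p gives the strict gap d + r < c + p when U
   drops below M. *)
have p0 : 0 < p by case: (A) oA bA => //= x s _ /andP[]; lia.
have aM' := alternating_shift ec aM; have aU' := alternating_shift ed aU.
have sM' := sorted_shift c sM; have sU' := sorted_shift d sU.
have pM : all (leq p) (map (addn^~ c) M).
  by rewrite all_map; apply: sub_all bM => x /=; clear; lia.
have pU : all (leq p) (map (addn^~ d) U).
  by rewrite all_map; apply: sub_all bU => x /=; clear -pq; lia.
case: cd => cd.
  exists (A ++ map (addn^~ c) M ++ map (addn^~ d) U); split=> //.
    apply: (@sorted_ltn_cat p) => //; last by rewrite all_cat pM.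
    apply: (@sorted_ltn_cat (q + c)) => //; rewrite all_map.
      by apply: sub_all bM => x /=; clear; lia.
    by apply: sub_all bU => x /=; clear -cd; lia.
  apply: alternating_cat => //; rewrite oA; apply: alternating_cat => //.
  by rewrite size_map (negbTE eM).
exists (A ++ map (addn^~ d) U ++ map (addn^~ c) M); split.
- by rewrite perm_cat2l perm_catC.
- apply: (@sorted_ltn_cat p) => //; last by rewrite all_cat pU.
  apply: (@sorted_ltn_cat (c + p)) => //; rewrite all_map.
    by apply: sub_all bU => x /=; clear -cd p0; lia.
  by apply: sub_all bM => x /=; clear; lia.
- apply: alternating_cat => //; rewrite oA; apply: alternating_cat => //.
  by rewrite size_map (negbTE eU).
Qed.

Section Labelling.

Variables (n p q : nat) (f : nat -> nat).

(* Labels below p belong to A, those in [p, q) to M and the others to U. *)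
Definition low_edge d := exists2 i, i < n &
  let x := f i in let y := f (next_index n i) in
  (x < p <= y /\ y = x + d) \/ (y < p <= x /\ x = y + d).

Definition high_edge d := exists2 i, i < n &
  let x := f i in let y := f (next_index n i) in
  ([&& p <= x, x < q & q <= y] /\ y = x + d) \/ ([&& p <= y, y < q & q <= x] /\ x = y + d).

(** The condition that yields every d + 2nk with k < m, up to sign: an edge at A suffices alone, an
    M-U edge needs its complement to 2n. The difference n is its own complement. *)
Definition attained d := low_edge d \/ (high_edge d /\ high_edge (2 * n - d)).

(** The lists give the sorted labels, [f] their cyclic order; since the sizes add up to n,
    [lab_onto] makes [f] injective on positions. Modulo v = 2nm + 1 the negative of d + 2nk is (2n +
    1 - d) + 2n(m - 1 - k), so one of d and 2n + 1 - d is enough. *)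
Record labelling (A M U : seq nat) : Prop := Labelling {
  lab_size : size A + size M + size U = n;
  lab_even : ~~ odd (size M) /\ ~~ odd (size U);
  lab_sorted : [/\ sorted ltn A, sorted ltn M & sorted ltn U];
  lab_A : all (fun x => x < p) A;
  lab_M : all (fun x => p <= x < q) M;
  lab_U : all (fun x => q <= x <= 2 * n) U;
  lab_bounds : p <= q <= 2 * n;
  lab_alternating : exists b,
    [/\ alternating b A, alternating (~~ b) M & alternating (~~ b) U];
  lab_onto : forall x, x \in A ++ M ++ U -> exists2 i, i < n & f i = x;
  lab_attained : forall d, 0 < d <= n -> attained d \/ attained (2 * n + 1 - d)
}.

Variables (m : nat) (A M U : seq nat).
Hypotheses (n2 : 2 < n) (odd_n : odd n) (fP : labelling A M U).

Definition spread j x :=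
  if x < p then x else if x < q then x + 2 * n * j else x + 2 * n * (m.-1 - j).

Let pq : p <= q.
Proof. by case: fP => _ _ _ _ _ _ /andP[]. Qed.

Let spreadA j x : x < p -> spread j x = x.
Proof. by rewrite /spread => ->. Qed.

Let spreadM j x : p <= x -> x < q -> spread j x = x + 2 * n * j.
Proof. by move=> px xq; rewrite /spread ltnNge px xq. Qed.

Let spreadU j x : q <= x -> spread j x = x + 2 * n * (m.-1 - j).
Proof. by move=> qx; rewrite /spread !ltnNge qx (leq_trans pq qx). Qed.

Definition base_cycle j := mkseq (fun i => spread j (f i)) n.

Lemma base_cycle_alternating j : j < m -> exists b s,
  [/\ perm_eq (base_cycle j) s, sorted ltn s,
      all (ltn^~ (2 * n * m).+1) s, alternating b s & size s = n].
Proof.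
move=> jm; case: fP => sz [eM eU] [sA sM sU] bA bM bU _ [b [aA aM aU]] onto _.
set j' := m.-1 - j.
have oA : odd (size A) by move: odd_n; rewrite -sz !oddD (negbTE eM) (negbTE eU) !addbF.
pose M' := [seq x + 2 * n * j | x <- M]; pose U' := [seq x + 2 * n * j' | x <- U].
have perm_f : perm_eq (mkseq f n) (A ++ M ++ U).
  have sAMU : sorted ltn (A ++ M ++ U).
    apply: (@sorted_ltn_cat p) => //.
      apply: (@sorted_ltn_cat q) => //; first by apply: sub_all bM => x /andP[].
      by apply: sub_all bU => x /andP[].
    rewrite all_cat; apply/andP; split; first by apply: sub_all bM => x /andP[].
    by apply: sub_all bU => x; lia.
  have uAMU := sorted_uniq ltn_trans ltnn sAMU.
  have sub : {subset A ++ M ++ U <= mkseq f n}.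
    by move=> x /onto[i i_n <-]; apply/mapP; exists i; rewrite ?mem_iota.
  have szs : size (mkseq f n) <= size (A ++ M ++ U).
    by rewrite size_mkseq !size_cat -sz addnA.
  rewrite perm_sym; apply: uniq_perm => //; first exact: leq_size_uniq sub szs.
  by have [] := uniq_min_size uAMU sub szs.
have perm_base : perm_eq (base_cycle j) (A ++ M' ++ U').
  rewrite /base_cycle /mkseq (map_comp (spread j) f).
  apply: perm_trans (perm_map _ perm_f) _; rewrite !map_cat.
  rewrite (_ : map _ A = A).
    rewrite (_ : map _ M = M'); first rewrite (_ : map _ U = U') //.
      by apply/eq_in_map => x /(allP bU) /andP[qx _]; apply: spreadU.
    by apply/eq_in_map => x /(allP bM) /andP[px xq]; apply: spreadM.
  by rewrite -[RHS]map_id; apply/eq_in_map => x /(allP bA); apply: spreadA.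
have even2 k : ~~ odd (2 * n * k) by rewrite -mulnA oddM.
have bnd k : k < m -> 2 * n * k + 2 * n <= 2 * n * m.
  by move=> km; rewrite -mulnSr leq_mul2l km orbT.
(* Both shifts are multiples of 2n, a bound for all labels, so U either stays above M or passes it
   entirely. *)
have order : 2 * n * j <= 2 * n * j' \/ 2 * n * j' + 2 * n <= 2 * n * j.
  have [jj'|j'j] := leqP j j'; first by left; rewrite leq_mul2l jj' orbT.
  by right; rewrite -mulnSr leq_mul2l j'j orbT.
have j'm : j' < m by rewrite /j'; clear -jm; lia.
have [s [perm_s ss alt]] := shift_blocks oA eM eU sA sM sU bA bM bU pq aA aM aU
  (even2 j) (even2 j') order.
exists b, s; split=> //; first exact: perm_trans perm_s.
  move: (bnd _ jm) (bnd _ j'm); rewrite -(perm_all _ perm_s) /M' /U'.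
  move: (2 * n * j) (2 * n * j') (2 * n * m) => c d v cv dv.
  have /andP[_ qn] := lab_bounds fP.
  rewrite !all_cat !all_map; apply/and3P; split.
  - by apply: sub_all bA => x /=; clear -pq qn cv; lia.
  - by apply: sub_all bM => x /=; clear -qn cv; lia.
  - by apply: sub_all bU => x /=; clear -dv; lia.
by rewrite -(perm_size perm_s) !size_cat !size_map addnA.
Qed.

Let attained_difference k d : 0 < d <= 2 * n -> k < m -> attained d ->
  exists j i, [/\ j < m, i < n &
    let x := nth 0 (base_cycle j) i in
    let y := nth 0 (base_cycle j) (next_index n i) in
    x + (d + 2 * n * k) = y \/ y + (d + 2 * n * k) = x].
Proof.
move=> dn km; have nthE j i : i < n -> nth 0 (base_cycle j) i = spread j (f i).
  by move=> i_n; rewrite nth_mkseq.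
have next_n i : i < n -> next_index n i < n.
  by rewrite /next_index; case: (ltnP i.+1) => //; lia.
(* Edges at A have a fixed lower end. The upper end moves by 2nk in base cycle k if it lies in M,
   and in base cycle m - 1 - k if it lies in U. *)
have high z : p <= z -> exists2 j, j < m & spread j z = z + 2 * n * k.
  move=> pz; have [zq|qz] := ltnP z q; first by exists k => //; apply: spreadM.
  exists (m.-1 - k); first by clear -km; lia.
  by rewrite spreadU // subKn //; clear -km; lia.
case=> [[i i_n /= h]|[]].
  case: h => [[/andP[xp py] yE]|[/andP[yp px] xE]].
    have [j jm jE] := high _ py; exists j, i; split=> //; left.
    by rewrite !nthE ?next_n // (spreadA _ xp) jE yE addnA.
  have [j jm jE] := high _ px; exists j, i; split=> //; right.
  by rewrite !nthE ?next_n // (spreadA _ yp) jE xE addnA.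
(* The shift of U relative to M runs over m-1, m-3, ..., 1-m; the negative
   shifts turn the residue 2n - d into the missing multiples for d. *)
have [par|par] := boolP (odd (m.-1 - k)); last first.
  (* With this j the block U moves exactly 2nk further than M. *)
  move=> [i i_n /= h] _; pose j := (m.-1 - k)./2.
  have jE : m.-1 - j = j + k by rewrite /j; clear -par km; lia.
  exists j, i; split=> //; first by rewrite /j; clear -km; lia.
  rewrite /= !nthE ?next_n //.
  case: h => [[/and3P[px xq qy] yE]|[/and3P[py yq qx] xE]].
    by left; rewrite (spreadM _ px xq) (spreadU _ qy) jE mulnDr yE; clear; lia.
  by right; rewrite (spreadM _ py yq) (spreadU _ qx) jE mulnDr xE; clear; lia.
(* Now M moves 2n(k + 1) further than U, and an edge of difference 2n - d turns over to 2n(k + 1) -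
   (2n - d) = d + 2nk. *)
move=> _ [i i_n /= h]; pose j := (m + k)./2.
have jE : j = (m.-1 - j + k).+1 by rewrite /j; clear -par km; lia.
exists j, i; split=> //; first by rewrite /j; clear -par km; lia.
have j2 : 2 * n * j = 2 * n * (m.-1 - j) + 2 * n * k + 2 * n.
  by rewrite {1}jE mulnSr mulnDr.
rewrite /= !nthE ?next_n //.
case: h => [[/and3P[px xq qy] yE]|[/and3P[py yq qx] xE]].
  right; rewrite (spreadM _ px xq) (spreadU _ qy) j2 yE; clear -dn; lia.
left; rewrite (spreadM _ py yq) (spreadU _ qx) j2 xE; clear -dn; lia.
Qed.

Lemma labelling_decomposition : exists D : {set {set {set 'I_(2 * n * m).+1}}},
  cycle_decomposition n (complete_edges 'I_(2 * n * m).+1) D /\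
  equitably_2_colourable n D.
Proof.
apply: (cyclic_decomposition n2 odd_n erefl base_cycle_alternating) => d dv.
(* Division is applied to d - 1 so that the remainder e lies in [1, 2n] rather than [0, 2n). *)
pose k := d.-1 %/ (2 * n); pose e := (d.-1 %% (2 * n)).+1.
have n20 : 0 < 2 * n by clear -n2; lia.
have dE : d = e + 2 * n * k.
  by rewrite addSn addnC mulnC -divn_eq prednK //; case/andP: dv.
have en : 0 < e <= 2 * n by rewrite /e ltn_pmod.
have km : k < m by rewrite /k ltn_divLR // mulnC; clear -dv; lia.
have [att|att] : attained e \/ attained (2 * n + 1 - e).
  clear -fP en; have [le|gt] := leqP e n; first by apply: (lab_attained fP); lia.
  have := lab_attained fP (d := 2 * n + 1 - e).
  by rewrite subKn; [case; [lia|right|left]|lia].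
  have [j [i [jm i_n /= h]]] := attained_difference en km att.
  by exists j, i; split=> //; rewrite dE; case: h => ->; [left|right].
(* The reflected class, with quotient m - 1 - k, provides v - d, that is, -d modulo v. *)
have en' : 0 < 2 * n + 1 - e <= 2 * n by clear -en; lia.
have km' : m.-1 - k < m by clear -km; lia.
have [j [i [jm i_n /= h]]] := attained_difference en' km' att.
have dE' : 2 * n + 1 - e + 2 * n * (m.-1 - k) + d = (2 * n * m).+1.
  have : 2 * n * m = 2 * n * (m.-1 - k) + 2 * n * k + 2 * n.
    by rewrite -mulnDr -mulnSr; congr (_ * _); clear -km; lia.
  by rewrite dE; clear -en; lia.
by exists j, i; split=> //=; case: h => <-; [right|left];
  rewrite -addnA dE' modnDr.
Qed.

End Labelling.

(** * The labellings *)

(** Zigzags a, b, a + 1, b - 1, ... and a, b, a - 1, b + 1, ...; started at the lower end for [up]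
    and at the upper end for [down], their consecutive differences decrease by one. *)
Definition up a b i := if odd i then b - i./2 else a + i./2.
Definition down a b i := if odd i then b + i./2 else a - i./2.

Ltac decide_ifs :=
  repeat match goal with |- context [if ?b then _ else _] =>
    lazymatch b with context [if _ then _ else _] => fail | _ => idtac end;
    first [rewrite (_ : b = true); last by lia
          |rewrite (_ : b = false); last by lia
          |case: (boolP b) => ?]
  end.

Ltac position i :=
  exists i; [lia | rewrite /next_index /up /down; decide_ifs; lia].

Ltac blocks :=
  repeat match goal with
  | |- is_true (all _ (_ ++ _)) => rewrite all_cat; apply/andP; split
  | |- is_true (all _ (iota _ _)) => apply/allP => ?; rewrite mem_iota; lia
  | |- alternating _ (_ ++ _) => apply: alternating_cat
  | |- alternating _ (iota _ _) => apply: alternating_iota; rewrite ?size_iota; lia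
  end.

Lemma sorted_iota_cat a k s :
  sorted ltn s -> all (leq (a + k)) s -> sorted ltn (iota a k ++ s).
Proof.
move=> ss sa; apply: (sorted_ltn_cat (k := a + k)) => //.
  exact: iota_ltn_sorted.
by apply/allP => x; rewrite mem_iota => /andP[].
Qed.

Ltac sorted_blocks :=
  repeat (apply: sorted_iota_cat; last by blocks); apply: iota_ltn_sorted.

Ltac labelling_fields :=
  split;
  [ by rewrite ?size_cat ?size_iota; lia
  | by rewrite ?size_cat ?size_iota; lia
  | by split; sorted_blocks
  | by blocks
  | by blocks
  | by blocks
  | lia
  | by exists false; split; blocks
  | |].

(* [label_r s] lists the labels around a cycle of length 8s + r. The families
   were found by a computer search for cycles made of a few zigzags. *)
Definition label_3 s i :=
  if i < 4 * s then up 0 (16 * s + 6) i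
  else if i < 4 * s + 4 then down (6 * s + 4) (2 * s + 2) (i - 4 * s)
  else down (10 * s + 4) (2 * s + 4) (i - (4 * s + 4)).

Lemma labelling_8s3 s : 0 < s ->
  labelling (8 * s + 3) (4 * s + 3) (14 * s + 7) (label_3 s)
    (iota 0 (2 * s) ++ iota (2 * s + 2) (2 * s + 1))
    (iota (6 * s + 3) 2 ++ iota (8 * s + 5) (2 * s))
    (iota (14 * s + 7) (2 * s)).
Proof.
move=> s0; labelling_fields.
- move=> x; rewrite !mem_cat !mem_iota /label_3 => /or3P[/orP[]|/orP[]|] h.
  + by position (2 * x).
  + by position (2 * x - 3).
  + by position (4 * s + 2 * (6 * s + 4 - x)).
  + by position (4 * s + 4 + 2 * (10 * s + 4 - x)).
  + by position (2 * (16 * s + 6 - x) + 1).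
- move=> d /andP[d0 dn]; rewrite /attained /low_edge /high_edge /label_3.
  (* The three zigzags give 2n + 1 - d for d up to 4s - 1, then d up to 4s + 2, then d up to 8s. The
     edges joining them give the rest; the one between the first two zigzags is the M-U edge of
     difference n. *)
  have [?|?] := leqP d (4 * s - 1); first by right; left; position (d - 1).
  have [?|?] := leqP d (4 * s + 2); first by left; left; position (8 * s + 2 - d).
  have [?|?] := leqP d (8 * s); first by left; left; position (12 * s + 4 - d).
  have [?|?] := eqVneq d (8 * s + 1); first by left; left; position (4 * s + 3).
  have [?|?] := eqVneq d (8 * s + 2); first by right; left; position (8 * s + 2).
  left; right; split; position (4 * s - 1).
Qed.

(** The first two branches are a single zigzag, cut where its upper labels pass from U to M. The
    extra label 6s + 8, the largest in A, links it to the last zigzag by differences 8s + 6 and 4s +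
    1. *)
Definition label_7 s i :=
  if i < 4 then down (16 * s + 14) 0 i
  else if i < 4 * s + 1 then down (16 * s + 12) 2 (i - 4)
  else if i == 4 * s + 1 then 6 * s + 8
  else down (10 * s + 9) (2 * s + 4) (i - (4 * s + 2)).

Lemma labelling_8s7 s : 0 < s ->
  labelling (8 * s + 7) (6 * s + 9) (16 * s + 13) (label_7 s)
    (iota 0 (2 * s) ++ iota (2 * s + 4) (2 * s + 2) ++ iota (6 * s + 8) 1)
    (iota (8 * s + 7) (2 * s + 3) ++ iota (14 * s + 14) (2 * s - 1))
    (iota (16 * s + 13) 2).
Proof.
move=> s0; labelling_fields.
- move=> x; rewrite !mem_cat !mem_iota /label_7.
  move=> /or3P[/or3P[]|/orP[]|] h.
  + by position (2 * x + 1).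
  + by position (2 * x - 5).
  + by position (4 * s + 1).
  + by position (4 * s + 2 + 2 * (10 * s + 9 - x)).
  + by position (4 + 2 * (16 * s + 12 - x)).
  + by position (2 * (16 * s + 14 - x)).
- move=> d /andP[d0 dn]; rewrite /attained /low_edge /high_edge /label_7.
  have [?|?] := leqP d (4 * s); first by right; left; position (d - 1).
  have [?|?] := eqVneq d (4 * s + 1); first by left; left; position (4 * s + 1).
  have [?|?] := leqP d (8 * s + 5); first by left; left; position (12 * s + 7 - d).
  have [?|?] := eqVneq d (8 * s + 6); first by left; left; position (4 * s).
  left; right; split; position (8 * s + 6).
Qed.

Definition label_5 s i :=
  if i < 4 * s + 2 then down (16 * s + 10) 0 i
  else if i == 4 * s + 2 then 6 * s + 2
  else if i == 4 * s + 3 then 10 * s + 5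
  else if i < 8 * s + 4 then up (2 * s + 1) (14 * s + 7) (i - (4 * s + 4))
  else 4 * s + 3.

Lemma labelling_8s5 s : 0 < s ->
  labelling (8 * s + 5) (4 * s + 1) (10 * s + 5) (label_5 s)
    (iota 0 (4 * s + 1))
    (iota (4 * s + 3) 1 ++ iota (6 * s + 2) 1)
    (iota (10 * s + 5) 1 ++ iota (12 * s + 8) (2 * s) ++
       iota (14 * s + 10) (2 * s + 1)).
Proof.
move=> s0; labelling_fields.
- move=> x; rewrite !mem_cat !mem_iota /label_5.
  move=> /or3P[|/orP[]|/or3P[]] h.
  + have [?|?] := leqP x (2 * s); first by position (2 * x + 1).
    by position (2 * x + 2).
  + by position (8 * s + 4).
  + by position (4 * s + 2).
  + by position (4 * s + 3).
  + by position (4 * s + 5 + 2 * (14 * s + 7 - x)).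
  + by position (2 * (16 * s + 10 - x)).
- move=> d /andP[d0 dn]; rewrite /attained /low_edge /high_edge /label_5.
  have [?|?] := leqP d (4 * s + 1); first by right; left; position (d - 1).
  have [?|?] := eqVneq d (4 * s + 2); first by left; left; position (4 * s + 1).
  (* The M-U differences 4s + 3 and 12s + 7 add up to 2n, and 12s + 7 = 2n + 1 - (4s + 4), so this
     one pair of edges settles both d = 4s + 3 and d = 4s + 4. *)
  have [?|?] := eqVneq d (4 * s + 3).
    by left; right; split; [position (4 * s + 2)|position (8 * s + 4)].
  have [?|?] := eqVneq d (4 * s + 4).
    by right; right; split; [position (8 * s + 4)|position (4 * s + 2)].
  have [?|?] := leqP d (8 * s + 3); first by right; left; position (d - 1).
  have [?|?] := eqVneq d (8 * s + 4); first by left; left; position (4 * s + 3).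
  by left; right; split; position (8 * s + 3).
Qed.

Definition label_1 s i :=
  if i < 4 * s + 1 then down (6 * s + 4) (2 * s + 3) i
  else if i == 4 * s + 1 then 16 * s + 2
  else if i == 4 * s + 2 then 0
  else if i == 4 * s + 3 then 4 * s + 3
  else if i == 4 * s + 4 then 1
  else if i < 8 * s then down (12 * s - 2) 2 (i - (4 * s + 5))
  else 14 * s + 5.

Lemma labelling_8s1 s : 1 < s ->
  labelling (8 * s + 1) (4 * s + 3) (14 * s + 5) (label_1 s)
    (iota 0 (2 * s - 1) ++ iota (2 * s + 3) (2 * s))
    (iota (4 * s + 3) (2 * s + 2) ++ iota (10 * s + 1) (2 * s - 2))
    (iota (14 * s + 5) 1 ++ iota (16 * s + 2) 1).
Proof.
move=> s1; labelling_fields.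
- move=> x; rewrite !mem_cat !mem_iota /label_1.
  move=> /or3P[/orP[]|/orP[]|/orP[]] h.
  + by position (4 * s + 2 + 2 * x).
  + by position (1 + 2 * (x - (2 * s + 3))).
  + have [?|?] := eqVneq x (4 * s + 3); first by position (4 * s + 3).
    by position (2 * (6 * s + 4 - x)).
  + by position (4 * s + 5 + 2 * (12 * s - 2 - x)).
  + by position (8 * s).
  + by position (4 * s + 1).
- move=> d /andP[d0 dn]; rewrite /attained /low_edge /high_edge /label_1.
  have [?|?] := eqVneq d 1; first by right; left; position (4 * s + 1).
  have [?|?] := leqP d (4 * s + 1); first by left; left; position (4 * s + 1 - d).
  have [?|?] := eqVneq d (4 * s + 2); first by left; left; position (4 * s + 3).
  have [?|?] := eqVneq d (4 * s + 3); first by left; left; position (4 * s + 2).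
  (* The complementary M-U pair is 4s + 4 and 12s - 2; it settles d = 4s + 4 and d = 4s + 5. *)
  have [?|?] := eqVneq d (4 * s + 4).
    by left; right; split; [position (8 * s - 1)|position (4 * s)].
  have [?|?] := eqVneq d (4 * s + 5).
    by right; right; split; [position (4 * s)|position (8 * s - 1)].
  have [?|?] := leqP d (8 * s); first by right; left; position (d - 2).
  by left; right; split; position (8 * s).
Qed.

(** * Sporadic labellings and the choice of family *)

Lemma labelling_7 :
  labelling 7 7 9 (nth 0 [:: 0; 9; 6; 8; 3; 7; 14])
    [:: 0; 3; 6] [:: 7; 8] [:: 9; 14].
Proof.
split=> //; first by exists false.
  have sub : {subset [:: 0; 3; 6; 7; 8; 9; 14] <=
      [:: 0; 9; 6; 8; 3; 7; 14]} by apply/allP.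
  by move=> x /sub xl; exists (index x [:: 0; 9; 6; 8; 3; 7; 14]);
    rewrite ?index_mem ?nth_index.
do 8?[case=> //] => _.
- by right; left; exists 6 => //; right.
- by left; left; exists 2 => //; left.
- by left; left; exists 1 => //; right.
- by left; left; exists 4 => //; left.
- by left; left; exists 3 => //; right.
- by right; left; exists 0 => //; left.
- by left; right; split; exists 5 => //; left.
Qed.

Lemma labelling_9 :
  labelling 9 3 7 (nth 0 [:: 0; 8; 1; 18; 3; 2; 7; 4; 13])
    [:: 0; 1; 2] [:: 3; 4] [:: 7; 8; 13; 18].
Proof.
split=> //; first by exists false.
  have sub : {subset [:: 0; 1; 2; 3; 4; 7; 8; 13; 18] <=
      [:: 0; 8; 1; 18; 3; 2; 7; 4; 13]} by apply/allP.
  by move=> x /sub xl; exists (index x [:: 0; 8; 1; 18; 3; 2; 7; 4; 13]);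
    rewrite ?index_mem ?nth_index.
(* One bullet for each d from 1 to 9; the M-U edges {4, 7} and {3, 18}, with 3 + 15 = 2 * 9, settle
   both d = 3 and d = 4. *)
do 10?[case=> //] => _.
- by left; left; exists 4 => //; right.
- by right; left; exists 2 => //; left.
- by left; right; split; [exists 6|exists 3] => //; right.
- by right; right; split; [exists 3|exists 6] => //; right.
- by left; left; exists 5 => //; left.
- by right; left; exists 8 => //; right.
- by left; left; exists 1 => //; right.
- by left; left; exists 0 => //; left.
- by left; right; split; exists 7 => //; left.
Qed.

(** Once 7 and 9 are handled by tables, s is at least 1, and at least 2 when n = 8s + 1. In
    [label_1] with s = 1 the positions 4s + 4 and 8s would coincide. *)
Lemma labelling_exists n : 7 <= n -> odd n ->
  exists p q f A M U, labelling n p q f A M U.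
Proof.
move=> n7 on.
have [->|n_7] := eqVneq n 7; first by do 6?eexists; exact: labelling_7.
have [->|n_9] := eqVneq n 9; first by do 6?eexists; exact: labelling_9.
pose s := n %/ 8.
have [nE|[nE|[nE|nE]]] : n = 8 * s + 1 \/ n = 8 * s + 3 \/ n = 8 * s + 5 \/ n = 8 * s + 7.
  by rewrite /s; lia.
- by do 6?eexists; rewrite nE; apply: labelling_8s1; lia.
- by do 6?eexists; rewrite nE; apply: labelling_8s3; lia.
- by do 6?eexists; rewrite nE; apply: labelling_8s5; lia.
- by do 6?eexists; rewrite nE; apply: labelling_8s7; lia.
Qed.

Theorem theorem6 (l v : nat) (hl : 7 <= l) (hodd : odd l)
    (hv : 0 < v) (hmod : v = 1 %[mod 2 * l]) :
  exists D : {set {set {set 'I_v}}},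
    cycle_decomposition l (complete_edges 'I_v) D /\ equitably_2_colourable l D.
Proof.
have [p [q [f [A [M [U labP]]]]]] := labelling_exists hl hodd.
(* The number m of base cycles is the quotient of v by 2l; it is 0 for v = 1. *)
have vE : v = (2 * l * (v %/ (2 * l))).+1.
  rewrite {1}(divn_eq v (2 * l)) hmod modn_small; last by lia.
  by rewrite addn1 mulnC.
by rewrite vE; apply: labelling_decomposition labP => //; lia.
Qed.
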